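(* Let $N$ be an abelian normal subgroup of a finite group $G$. Then the following hold: (1) An automorphism $\phi$ of $G/N$ lifts to an automorphism of $G$ centralizing $N$ provided that, for each prime number $p$ dividing $|G/N|$, there is some Sylow $p$-subgroup $P/N$ of $G/N$ such that the restriction of $\phi$ to $P/N$ lifts to an automorphism of $P$ centralizing $N$. (2) If an automorphism $\phi$ of $G/N$ lifts to an automorphism of $G$ centralizing $N$, then the restriction of $\phi$ to any characteristic subgroup $P/N$ of $G/N$ lifts to an automorphism of $P$ centralizing $N$.
   Context: For a subgroup $P$ with $N\le P\le G$ and an automorphism $\phi$ of $G/N$, ''the restriction of $\phi$ to $P/N$ lifts to an automorphism of $P$ centralizing $N$'' means that $\phi(P/N)=P/N$ and there is an automorphism $\gamma$ of $P$ with $\gamma(n)=n$ for all $n\in N$ and $\gamma(g)N=\phi(gN)$ for all $g\in P$. The case $P=G$ gives the meaning of ''$\phi$ lifts to an automorphism of $G$ centralizing $N$''. *)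

(* Defs.v *)
From mathcomp Require Import all_boot all_fingroup all_solvable.

Set Implicit Arguments.
Unset Strict Implicit.
Unset Printing Implicit Defensive.

Local Open Scope group_scope.

(* The restriction of phi to P / N lifts to an automorphism of P centralizing
   N. Intended for N <| G, N \subset P \subset G and phi \in Aut (G / N);
   coset N g is the coset of g only for g in the normaliser of N. *)
Definition restr_lifts (gT : finGroupType) (N P : {group gT})
    (phi : {perm coset_of N}) : Prop :=
  phi @: (P / N) = P / N /\
  exists gamma : {perm gT},
    [/\ gamma \in Aut P,
        {in N, forall n, gamma n = n} &
        {in P, forall g, coset N (gamma g) = phi (coset N g)}].

(* Main.v *)
(* In the fibre product E = {(g, h) in G x G | phi(gN) = hN}, the lifts of phi
   that centralize N are exactly the subgroups C (their graphs) such that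
   C(N x N) = E and C meets N x N in the diagonal D of N. So phi lifts iff D is
   normal in E and E/D splits over the abelian group (N x N)/D. Both conditions
   can be checked on the subgroups of E lying over Sylow subgroups of G/N:
   normality because the index of 'N_E(D) is then prime to every p, splitting
   by Gaschutz's theorem. *)
Require Import Defs.
From mathcomp Require Import all_boot all_fingroup all_solvable.

Local Open Scope group_scope.

(** * Splitting over an abelian normal subgroup, one prime at a time *)

Lemma mulg_setI_coprime {gT : finGroupType} (A E K L : {group gT}) :
  A * K = E -> A * L = E -> coprime #|A : K| #|A : L| -> A * (K :&: L) = E.
Proof.
move=> AKE ALE co; have sLE: L \subset E by rewrite -ALE mulG_subr.
have AKL: (A :&: K) * (A :&: L) = A.
  by apply: coprime_index_mulG; rewrite ?subsetIl // !indexgI.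
apply/eqP; rewrite eqEsubset mul_subG ?subIset ?sLE ?orbT //=; last first.
  by rewrite -AKE mulG_subl.
apply/subsetP=> e Ee.
have: e \in A * K by rewrite AKE.
case/mulsgP=> a k Aa Kk def_e.
have: e \in A * L by rewrite ALE.
case/mulsgP=> b l Ab Ll def_e'.
(* Since [e = a * k = b * l], factoring [a^-1 * b] as [u * v] gives [u^-1 * k = v * l], an element
   of both [K] and [L]. *)
have: a^-1 * b \in (A :&: K) * (A :&: L) by rewrite AKL !in_group.
case/mulsgP=> u v /setIP[Au Ku] /setIP[Av Lv] def_uv.
have def_k: u^-1 * k = v * l.
  apply: (mulgI (a * u)); rewrite !mulgA mulgK -def_e.
  by rewrite -(mulgA a u v) -def_uv mulgA mulgV mul1g.
apply/mulsgP; exists (a * u) (u^-1 * k); last by rewrite mulgA mulgK.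
  exact: groupM.
by apply/setIP; split; last rewrite def_k; rewrite groupM ?groupV.
Qed.

(** Modulo ['O_p^'(A)] the group [A] becomes a p-group, so its order is coprime to the index of the
    image of [P], and Gaschutz's theorem applies. [K] is the preimage of the resulting complement,
    hence meets [A] in ['O_p^'(A)]. *)
Lemma splits_pcore_quotient {gT : finGroupType} {p : nat} {A E P : {group gT}} :
    A <| E -> abelian A -> A \subset P -> P \subset E ->
    p^'.-nat #|E : P| -> [splits P, over A] ->
  exists2 K : {group gT}, A * K = E & p^'.-Hall(A) (A :&: K).
Proof.
move=> nsAE abA sAP sPE p'EP /splitsP[L /complP[tiAL defP]].
set B := 'O_p^'(A)%G.
have sBA: B \subset A := pcore_sub _ _.
have nBE: E \subset 'N(B) := char_norm_trans (pcore_char _ _) (normal_norm nsAE).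
have sAE := normal_sub nsAE.
have sLE: L \subset E by rewrite (subset_trans _ sPE) // -defP mulG_subr.
have nBA := subset_trans sAE nBE; have nBL := subset_trans sLE nBE.
have hallB: p^'.-Hall(A) B by apply: nilpotent_pcore_Hall; apply: abelian_nil.
have pAB: p.-group (A / B).
  by case/and3P: hallB => _ _; rewrite /pgroup card_quotient // pnatNK.
have: [splits E / B, over A / B].
  rewrite (@Gaschutz_split _ _ _ (P / B)%G) ?quotient_normal ?quotientS ?quotient_abelian //.
    apply/splitsP; exists (L / B)%G; apply/complP; split.
      (* [B * L] has the same image as [L] and contains [B]; by the modular law it meets [A] in
         [B * (A :&: L)], that is, in [B]. *)
      rewrite /= -(quotientMidl B L) -quotientGI //.
      by rewrite setIC -group_modl // setIC tiAL mulg1 trivg_quotient.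
    by rewrite -quotientMl // defP.
  rewrite index_quotient_eq ?subIset ?(subset_trans sBA) ?orbT //.
  exact: pnat_coprime pAB p'EP.
case/splitsP=> Kb /complP[tiAK defE].
have nsBE: B <| E by apply/andP; rewrite (subset_trans sBA).
have sKbE: Kb \subset E / B by rewrite -defE mulG_subr.
have [K defK sBK sKE] := inv_quotientS nsBE sKbE.
have AIK: A :&: K = B.
  apply/eqP; rewrite eqEsubset subsetI sBA sBK !andbT -quotient_sub1.
    by rewrite quotientGI // -defK tiAK.
  by rewrite subIset ?nBA.
exists K; last by rewrite AIK.
have AKsub: A * K \subset E by rewrite mul_subG.
apply/eqP; rewrite eqEsubset AKsub -(mulSGid sBA) -mulgA -quotientSK //.
by rewrite quotientMl // -defK defE subxx.
Qed.

(* Gaschutz's theorem, freed from its coprimality condition by intersecting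
   the preimages of the complements found modulo each 'O_p^'(A). *)
Lemma splits_Sylow_local {gT : finGroupType} (A E : {group gT}) :
    A <| E -> abelian A ->
    (forall p : nat, prime p -> exists P : {group gT},
       [/\ A \subset P, P \subset E, p^'.-nat #|E : P| & [splits P, over A]]) ->
  [splits E, over A].
Proof.
move=> nsAE abA locA.
(* Each [K] here meets [A] in a Hall subgroup of [A]. A round of the induction removes a prime from
   the order of [A :&: K], until [K] is a complement. *)
have main n (K : {group gT}) : #|A :&: K| < n -> A * K = E ->
    coprime #|A :&: K| #|A : A :&: K| -> [splits E, over A].
  elim: n K => // n IHn K; rewrite ltnS => leKn AKE coK.
  have [trAK | ntAK] := eqVneq #|A :&: K| 1%N.
    by apply/splitsP; exists K; apply/complP; rewrite (card1_trivg trAK).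
  pose p := pdiv #|A :&: K|.
  have p_pr: prime p by rewrite pdiv_prime // ltn_neqAle eq_sym ntAK cardG_gt0.
  have pAK: p %| #|A :&: K| := pdiv_dvd _.
  have [P [sAP sPE p'EP splP]] := locA p p_pr.
  have [L ALE /and3P[_ p'AL pAL]] := splits_pcore_quotient nsAE abA sAP sPE p'EP splP.
  rewrite pnatNK in pAL.
  have p'AK: p^'.-nat #|A : A :&: K|.
    rewrite p'natE // -prime_coprime //; exact: coprime_dvdl pAK coK.
  have coKL: coprime #|A : A :&: K| #|A : A :&: L|.
    by rewrite coprime_sym; apply: pnat_coprime pAL p'AK.
  have AKLE: A * (K :&: L) = E by apply: mulg_setI_coprime; rewrite // -(indexgI A K) -(indexgI A L).
  have p'AKL: p^'.-group (A :&: (K :&: L)).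
    by apply: pgroupS p'AL; rewrite setIS ?subsetIr.
  have sKL: A :&: (K :&: L) \subset A :&: K by rewrite setIS ?subsetIl.
  have dvKL := cardSg sKL.
  apply: IHn AKLE _ => /=.
    apply: leq_trans leKn; rewrite ltn_neqAle dvdn_leq ?cardG_gt0 // andbT.
    apply: contraTneq pAK => <-; rewrite -p'natE //.
  (* The first factor is coprime to the order of [A :&: K], the second is a power of [p], and
     [A :&: (K :&: L)] is a p'-subgroup of [A :&: K]; so the Hall condition persists. *)
  have -> : #|A : A :&: (K :&: L)| = (#|A : A :&: K| * #|A : A :&: L|)%N.
    rewrite -(Lagrange_index (subsetIl A K) sKL); congr (_ * _)%N.
    have AKL: (A :&: L) * (A :&: K) = A.
      by apply: coprime_index_mulG; rewrite ?subsetIl // coprime_sym.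
    have /= := indexMg (A :&: L)%G (A :&: K).
    by rewrite AKL => ->; rewrite setIIr -(indexgI (A :&: K)%G (A :&: L)%G).
  rewrite coprimeMr (coprime_dvdl dvKL coK) coprime_sym.
  exact: pnat_coprime pAL p'AKL.
apply: (main #|A|.+1 E).
- by rewrite ltnS subset_leq_card ?subsetIl.
- exact: mulSGid (normal_sub nsAE).
- by rewrite (setIidPl (normal_sub nsAE)) indexgg coprimen1.
Qed.

(** [C] plays the role of the preimage of a complement of [A / D] in [E / D]. Phrased inside [E],
    the statement makes sense before [D] is known to be normal. *)
Lemma complement_mod_Sylow_local {gT : finGroupType} {A D E : {group gT}} :
    A <| E -> abelian A -> D \subset A ->
    (forall p : nat, prime p -> exists P C : {group gT},
       [/\ P \subset E, p^'.-nat #|E : P|, A :&: C = D & A * C = P]) ->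
  exists2 C : {group gT}, A :&: C = D & A * C = E.
Proof.
move=> nsAE abA sDA locE; have [sAE nAE] := andP nsAE.
(* The normaliser of D contains a subgroup of index prime to p, for every p. *)
have nDE: E \subset 'N(D).
  rewrite -indexg_eq1 -indexgI; apply: contraT => ntI.
  have p_pr: prime (pdiv #|E : E :&: 'N(D)|).
    by rewrite pdiv_prime // ltn_neqAle eq_sym ntI indexg_gt0.
  have [P [C [sPE p'EP defD defP]]] := locE _ p_pr.
  (* [A] normalizes [D] because it is abelian, and [C] normalizes [D = A :&: C] because [A] is
     normal in [E]. *)
  have nDP: P \subset E :&: 'N(D).
    have sCE: C \subset E by rewrite (subset_trans _ sPE) // -defP mulG_subr.
    rewrite subsetI sPE -defP mul_subG ?(sub_abelian_norm abA) //.
    by rewrite -defD normsI ?normG ?(subset_trans sCE).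
  have := pnat_dvd (indexgS E nDP) p'EP.
  by rewrite p'natE // pdiv_dvd.
have nDA := subset_trans sAE nDE.
have nsDE: D <| E by rewrite /normal (subset_trans sDA).
have: [splits E / D, over A / D].
  apply: splits_Sylow_local; rewrite ?quotient_normal ?quotient_abelian //.
  move=> p /locE[P [C [sPE p'EP defD defP]]].
  have sAP: A \subset P by rewrite -defP mulG_subl.
  exists (P / D)%G; split; rewrite ?quotientS //.
    by rewrite index_quotient_eq // subIset // (subset_trans sDA) ?orbT.
  apply/splitsP; exists (C / D)%G; apply/complP; split.
    by rewrite -quotientGI // defD trivg_quotient.
  by rewrite -quotientMl // defP.
case/splitsP=> Cb /complP[tiAC defE].
have sCbE: Cb \subset E / D by rewrite -defE mulG_subr.
have [C defC sDC sCE] := inv_quotientS nsDE sCbE.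
exists C.
  apply/eqP; rewrite eqEsubset subsetI sDA sDC !andbT -quotient_sub1.
    by rewrite quotientGI // -defC tiAC.
  by rewrite subIset ?nDA.
apply/eqP; rewrite eqEsubset mul_subG //= -(mulSGid sDA) -mulgA -quotientSK //.
by rewrite quotientMl // -defC defE subxx.
Qed.

(** * Fibre products and their orders *)

(** One encoding covers the fibre product [E], the graph of a lift and the diagonal of [N]. *)
Definition pullback {gT rT : finGroupType} (P : {set gT}) (f1 f2 : gT -> rT) :
  {set gT * gT} := [set u in setX P P | f1 u.1 == f2 u.2].

Lemma pullbackP {gT rT : finGroupType} (P : {set gT}) (f1 f2 : gT -> rT) a b :
  reflect [/\ a \in P, b \in P & f1 a = f2 b] ((a, b) \in pullback P f1 f2).
Proof.
rewrite !inE /=; apply: (iffP andP) => [[/andP[-> ->] /eqP] | [-> -> ->]] //.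
Qed.

Lemma group_set_pullback (gT rT : finGroupType) (P : {group gT}) (f1 f2 : gT -> rT) :
    {in P &, {morph f1 : x y / x * y}} -> {in P &, {morph f2 : x y / x * y}} ->
  group_set (pullback P f1 f2).
Proof.
move=> f1M f2M; apply/group_setP; split=> [|[a b] [c d]].
  have f11 (f : gT -> rT) : {in P &, {morph f : x y / x * y}} -> f 1 = 1.
    by move=> fM; apply: (mulgI (f 1)); rewrite -fM ?mulg1.
  by apply/pullbackP; rewrite !f11.
case/pullbackP=> Pa Pb fab /pullbackP[Pc Pd fcd].
by apply/pullbackP; rewrite f1M ?f2M ?groupM ?fab ?fcd.
Qed.

Lemma coset_morphM {gT : finGroupType} {G N : {group gT}} :
  N <| G -> {in G &, {morph coset N : x y / x * y}}.
Proof. by move=> /andP[_ nNG] x y Gx Gy; rewrite morphM ?(subsetP nNG). Qed.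

Lemma Aut_coset_morphM {gT : finGroupType} {G N : {group gT}}
    {phi : {perm coset_of N}} :
    N <| G -> phi \in Aut (G / N) ->
  {in G &, {morph (fun g => phi (coset N g)) : x y / x * y}}.
Proof.
move=> nsNG /Aut_morphic/morphicP phiM x y Gx Gy.
by rewrite (coset_morphM nsNG) // phiM ?mem_quotient.
Qed.

Lemma Aut1 {rT : finGroupType} {H : {group rT}} {a : {perm rT}} :
  a \in Aut H -> a 1 = 1.
Proof. by move=> AutHa; rewrite -(autmE AutHa) morph1. Qed.

Definition fiber_square {gT : finGroupType} (N P : {set gT})
  (phi : {perm coset_of N}) := pullback P (fun g => phi (coset N g)) (coset N).

Lemma fiber_square_group_set {gT : finGroupType} {G N P : {group gT}}
    {phi : {perm coset_of N}} :
    N <| G -> phi \in Aut (G / N) -> P \subset G ->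
  group_set (fiber_square N P phi).
Proof.
move=> nsNG Aphi sPG; apply: group_set_pullback; apply: sub_in2 (subsetP sPG) _ _.
  exact: Aut_coset_morphM.
exact: coset_morphM.
Qed.

(** The first projection has kernel [setX 1 N] on the fibre square, and its image is all of [P]
    because [phi] stabilizes [P / N]. *)
Lemma card_fiber_square {gT : finGroupType} {G N P : {group gT}}
    {phi : {perm coset_of N}} :
    N <| G -> phi \in Aut (G / N) -> N \subset P -> P \subset G ->
    phi @: (P / N) = P / N ->
  #|fiber_square N P phi| = (#|N| * #|P|)%N.
Proof.
move=> nsNG Aphi sNP sPG phiP.
pose E := Group (fiber_square_group_set nsNG Aphi sPG).
have nNP := subset_trans sPG (normal_norm nsNG).
rewrite -[fiber_square _ _ _]/(E : {set _}).
rewrite -(LagrangeI E ('ker (fst_morphism gT gT))).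
have -> : E :&: 'ker (fst_morphism gT gT) = setX 1 N.
  apply/setP=> -[a b]; rewrite inE; apply/andP/setXP => [[/pullbackP[Pa Pb]]|].
    move=> eab /morphpreP[_ /set1P /= a1].
    rewrite a1 coset_id // (Aut1 Aphi) in eab.
    by rewrite a1 set11 coset_idr // (subsetP nNP).
  case=> /set1P-> Nb; split; last by apply/morphpreP; rewrite !inE.
  by apply/pullbackP; rewrite !coset_id // (Aut1 Aphi) group1 (subsetP sNP).
rewrite cardsX cards1 mul1n; congr (_ * _)%N.
rewrite -(setTI E) -card_morphim; congr #|pred_of_set _|.
apply/setP=> g; apply/morphimP/idP=> [[[a b] _ Eab ->] | Pg].
  by have /pullbackP[] := Eab : (a, b) \in fiber_square N P phi.
have: phi (coset N g) \in P / N by rewrite -phiP imset_f // mem_quotient.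
by case/morphimP=> h _ Ph def_h; exists (g, h); [rewrite inE | apply/pullbackP |].
Qed.

(** * Lifts as graphs inside the fibre square *)

(** [C] is the graph of the lift [gam]. If [phi] sends the coset of [a] to that of [b], then
    [b = n * gam a] with [n] in [N], so [(a, b) = (1, n) * (a, gam a)]. *)
Lemma restr_lifts_complement {gT : finGroupType} {G N P : {group gT}}
    {phi : {perm coset_of N}} :
    N <| G -> phi \in Aut (G / N) -> N \subset P -> P \subset G ->
    restr_lifts P phi ->
  exists C : {group gT * gT},
    setX N N :&: C = pullback N id id /\ setX N N * C = fiber_square N P phi.
Proof.
move=> nsNG Aphi sNP sPG [_ [gam [Agam gamN gamP]]].
have nNP := subset_trans sPG (normal_norm nsNG).
have gPP g : g \in P -> gam g \in P by move=> Pg; rewrite Aut_closed.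
have gC: group_set (pullback P gam id).
  by apply: group_set_pullback => //; apply/morphicP/Aut_morphic.
exists (Group gC); split; apply/setP=> -[a b].
  rewrite inE; apply/andP/pullbackP=> /=.
    by case=> /setXP[Na Nb] /pullbackP[_ _ <-]; rewrite gamN.
  case=> Na Nb <-; split; first exact/setXP.
  by apply/pullbackP; rewrite gamN // (subsetP sNP).
apply/mulsgP/pullbackP => [[[m n] [g h] /setXP[Nm Nn] /pullbackP[Pg Ph def_h]]|].
  case=> -> ->; have [Pm Pn] := (subsetP sNP _ Nm, subsetP sNP _ Nn).
  split; rewrite ?groupM // !morphM ?(subsetP nNP) //= (coset_id Nm) (coset_id Nn) !mul1g.
  by rewrite -gamP // def_h.
case=> Pa Pb; rewrite -gamP // => /esym/kercoset_rcoset[].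
- exact: (subsetP nNP).
- by rewrite (subsetP nNP) ?gPP.
move=> n Nn ->; exists (1, n) (a, gam a); first by apply/setXP.
  by apply/pullbackP; split; rewrite ?gPP.
by congr pair; rewrite mul1g.
Qed.

(** [C] is the graph of the lift: if [(1, h)] is in [C], then [h] is in [N], so the pair is diagonal
    and [h = 1]. Thus [C] is single-valued; the other coordinate gives injectivity, and the diagonal
    inside [C] makes the lift fix [N]. *)
Lemma complement_restr_lifts {gT : finGroupType} {G N : {group gT}}
    {phi : {perm coset_of N}} {C : {group gT * gT}} :
    N <| G -> phi \in Aut (G / N) ->
    setX N N :&: C = pullback N id id -> setX N N * C = fiber_square N G phi ->
  restr_lifts G phi.
Proof.
move=> nsNG Aphi defD defE; have [sNG nNG] := andP nsNG.
have CE g h : (g, h) \in C -> [/\ g \in G, h \in G & phi (coset N g) = coset N h].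
  move=> Cgh; have: (g, h) \in fiber_square N G phi by rewrite -defE (subsetP (mulG_subr _ _)).
  by move/pullbackP.
have diagC n : n \in N -> (n, n) \in C.
  by move=> Nn; have: (n, n) \in pullback N id id; [apply/pullbackP | rewrite -defD => /setIP[]].
have C1 h : (1, h) \in C -> h = 1.
  move=> Ch; have [_ Gh] := CE _ _ Ch.
  rewrite coset_id // (Aut1 Aphi) => /esym/coset_idr Nh.
  have: (1, h) \in setX N N :&: C by rewrite inE Ch andbT; apply/setXP; rewrite Nh ?(subsetP nNG).
  by rewrite defD => /pullbackP[].
have C2 g : (g, 1) \in C -> g = 1.
  move=> Cg; have [Gg _] := CE _ _ Cg.
  rewrite (coset_id (group1 N)) -(Aut1 Aphi) => /perm_inj/coset_idr Ng.
  have: (g, 1) \in setX N N :&: C by rewrite inE Cg andbT; apply/setXP; rewrite Ng ?(subsetP nNG).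
  by rewrite defD => /pullbackP[].
have Cuniq g h h' : (g, h) \in C -> (g, h') \in C -> h = h'.
  move=> Ch Ch'; have: (g * g^-1, h * h'^-1) \in C := groupM Ch (groupVr Ch').
  by rewrite mulgV => /C1/(canRL (mulgKV _)); rewrite mul1g.
(* The default value 1 is never reached for [g] in [G], as [cC] shows. *)
pose c g := odflt 1 [pick h | (g, h) \in C].
have cC g : g \in G -> (g, c g) \in C.
  move=> Gg; rewrite /c; case: pickP => //= noC.
  have /morphimP[h Nh Gh def_h]: phi (coset N g) \in G / N.
    by rewrite Aut_closed // mem_quotient.
  have: (g, h) \in setX N N * C by rewrite defE; apply/pullbackP.
  case/mulsgP=> -[m n] [g' h'] /setXP[Nm _] Cgh' [def_g _].
  (* Multiplying by the diagonal pair [(m, m)] instead of [(m, n)] restores the first coordinate [g]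
     without leaving [C]. *)
  have: (m * g', m * h') \in C := groupM (diagC m Nm) Cgh'.
  by rewrite -def_g => Cg; have := noC (m * h'); rewrite Cg.
have cM : {in G &, {morph c : x y / x * y}}.
  move=> x y Gx Gy; apply: (Cuniq (x * y)); first by rewrite cC ?groupM.
  exact: (groupM (cC x Gx) (cC y Gy)).
pose f := Morphism cM.
have injf : 'injm f.
  apply/subsetP=> x /morphpreP[Gx /set1P /= cx1]; apply/set1P/C2.
  by rewrite -cx1 cC.
have fG : f @* G = G.
  apply/eqP; rewrite eqEcard card_injm // leqnn andbT.
  by apply/subsetP=> _ /morphimP[x _ Gx ->]; have [] := CE _ _ (cC x Gx).
split.
  apply/eqP; rewrite eqEcard card_imset ?leqnn ?andbT; last exact: perm_inj.
  by apply/subsetP=> _ /imsetP[x Gx ->]; rewrite Aut_closed.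
exists (aut injf fG); split=> [|n Nn|g Gg]; first exact: Aut_aut.
  by rewrite autE ?(subsetP sNG) //=; apply: (Cuniq n); rewrite ?diagC ?cC ?(subsetP sNG).
by rewrite autE //=; have [] := CE _ _ (cC g Gg).
Qed.

(** * Special subgroups, and the theorem itself *)

(** The lift on [G] restricts to [P]: [phi] stabilizes the characteristic subgroup [P / N], and [P]
    is its full preimage. *)
Lemma restr_lifts_char {gT : finGroupType} {G N P : {group gT}}
    {phi : {perm coset_of N}} :
    N <| G -> phi \in Aut (G / N) -> restr_lifts G phi ->
    N \subset P -> P \subset G -> P / N \char G / N ->
  restr_lifts P phi.
Proof.
move=> nsNG Aphi [_ [gam [Agam gamN gamG]]] sNP sPG chP.
have phiP: phi @: (P / N) = P / N.
  have /charP[_ /(_ _ (injm_autm Aphi) (im_autm Aphi))] := chP.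
  by rewrite morphimEsub ?quotientS.
split=> //.
have nNP := subset_trans sPG (normal_norm nsNG).
pose f := [morphism of restrm sPG (autm Agam)].
have injf: 'injm f by rewrite injm_restrm ?injm_autm.
have fP: f @* P = P.
  apply/eqP; rewrite eqEcard card_injm // leqnn andbT.
  apply/subsetP=> _ /morphimP[g _ Pg ->] /=; have Gg := subsetP sPG _ Pg.
  have Ggam: gam g \in G by rewrite Aut_closed.
  rewrite -[restrm _ _ _]/(gam g) -(quotientGK (_ : N <| P)); last by rewrite /normal sNP.
  apply/morphpreP; split; first exact: (subsetP (normal_norm nsNG)).
  by rewrite /= gamG // -phiP imset_f // mem_quotient.
exists (aut injf fP); split=> [|n Nn|g Pg]; first exact: Aut_aut.
  by rewrite autE ?(subsetP sNP) //; apply: gamN.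
by rewrite autE //; apply/gamG/(subsetP sPG).
Qed.

(** The identity is a lift. This case serves the primes not dividing the order of [G / N]. *)
Lemma restr_lifts_normal_sub {gT : finGroupType} {G N : {group gT}}
    {phi : {perm coset_of N}} :
  phi \in Aut (G / N) -> restr_lifts N phi.
Proof.
move=> Aphi; split; first by rewrite trivg_quotient imset_set1 (Aut1 Aphi).
exists 1; split=> [|n _|g Ng]; rewrite ?group1 ?perm1 //.
by rewrite coset_id // (Aut1 Aphi).
Qed.

Theorem theorem4 (gT : finGroupType) (G N : {group gT})
    (nsNG : N <| G) (abN : abelian N) :
  (forall phi : {perm coset_of N}, phi \in Aut (G / N) ->
     (forall p : nat, prime p -> p %| #|G / N| ->
        exists P : {group gT},
          [/\ N \subset P, P \subset G,
              p.-Sylow(G / N) (P / N) & restr_lifts P phi]) ->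
     restr_lifts G phi) /\
  (forall phi : {perm coset_of N}, phi \in Aut (G / N) ->
     restr_lifts G phi ->
     forall P : {group gT}, N \subset P -> P \subset G ->
       P / N \char G / N -> restr_lifts P phi).
Proof.
have [sNG nNG] := andP nsNG.
split=> phi Aphi; last by move=> liftG P; apply: restr_lifts_char nsNG Aphi liftG.
move=> liftSyl.
have liftp p : prime p -> exists P : {group gT},
    [/\ N \subset P, P \subset G, p^'.-nat #|G : P| & restr_lifts P phi].
  move=> p_pr; have [/(liftSyl p p_pr)[P [sNP sPG /and3P[_ _ p'GP] liftP]] | p'GN] :=
    boolP (p %| #|G / N|); [exists P | exists N]; split=> //.
  - by rewrite -(index_quotient_eq (H := N)) // subIset // sNP orbT.
  - by rewrite -card_quotient // p'natE.
  exact: restr_lifts_normal_sub Aphi.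
have phiG: phi @: (G / N) = G / N.
  by rewrite -[RHS](im_autm Aphi) morphimEdom.
pose E := Group (fiber_square_group_set nsNG Aphi (subxx G)).
have gD: group_set (pullback N id id) by apply: group_set_pullback.
have nsNNE: setX N N <| E.
  apply/andP; split.
    apply/subsetP=> -[a b] /setXP[Na Nb]; apply/pullbackP.
    by rewrite !coset_id // (Aut1 Aphi) !(subsetP sNG).
  apply/subsetP=> -[g h] /pullbackP[Gg Gh _]; rewrite inE.
  apply/subsetP=> _ /imsetP[[a b] /setXP[Na Nb] ->]; apply/setXP.
  by split; rewrite memJ_norm // (subsetP nNG).
have abNN: abelian (setX N N).
  apply/centsP=> -[a b] /setXP[Na Nb] [c d] /setXP[Nc Nd].
  by congr pair; apply: (centsP abN).
have sDNN: Group gD \subset setX N N.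
  by apply/subsetP=> -[a b] /pullbackP[Na Nb _]; apply/setXP.
have [|C] := complement_mod_Sylow_local nsNNE abNN sDNN; last first.
  exact: complement_restr_lifts.
move=> p /liftp[P [sNP sPG p'GP liftP]].
have [C [defD defP]] := restr_lifts_complement nsNG Aphi sNP sPG liftP.
have sPE: Group (fiber_square_group_set nsNG Aphi sPG) \subset E.
  apply/subsetP=> -[a b] /pullbackP[Pa Pb eab].
  by apply/pullbackP; rewrite !(subsetP sPG).
exists (Group (fiber_square_group_set nsNG Aphi sPG)), C; split=> //.
(* The orders of the two fibre squares share the factor [#|N|], so the index reduces to [#|G : P|],
   which is prime to [p]. *)
rewrite -divgS //= (card_fiber_square nsNG Aphi sNP sPG liftP.1).
by rewrite (card_fiber_square nsNG Aphi) // divnMl // divgS.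
Qed.
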